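(* The collection $(\mathcal{A}_\xi)_{\xi<\omega_1}$ of families of finite subsets of $\mathbb{N}$ defined by the Schreier type construction given in the context is a system of uniform families on $\mathbb{N}$.
   Context: $\mathbb{N}=\{1,2,3,\dots\}$. For an infinite $M\subseteq\mathbb{N}$, $[M]^{<\omega}$ is the set of all finite subsets of $M$ and $[M]$ the set of all infinite subsets of $M$. For finite sets, $s<t$ means $\max s<\min t$ (vacuously true if one of them is empty). Uniform families. Let $M\in[\mathbb{N}]$ and $\mathcal{L}\subseteq[M]^{<\omega}$. For $m\in M$ put $\mathcal{L}(m)=\{s\in[M]^{<\omega}:\{m\}\cup s\in\mathcal{L}\text{ and }\{m\}<s\}$. For countable ordinals $\xi$, ''$\mathcal{L}$ is $\xi$-uniform on $M$'' is defined recursively: (1) $\mathcal{L}$ is $0$-uniform on $M$ if $\mathcal{L}=\{\emptyset\}$; (2) if $\xi=\zeta+1$, $\mathcal{L}$ is $\xi$-uniform on $M$ if $\emptyset\notin\mathcal{L}$ and $\mathcal{L}(m)$ is $\zeta$-uniform on $M\cap(m,+\infty)$ for every $m\in M$; (3) if $\xi$ is a nonzero limit ordinal, $\mathcal{L}$ is $\xi$-uniform on $M$ if $\emptyset\notin\mathcal{L}$ and there is an increasing sequence $(\xi_m)_{m\in M}$ of ordinals smaller than $\xi$ with $\sup_m\xi_m=\xi$ such that $\mathcal{L}(m)$ is $\xi_m$-uniform on $M\cap(m,+\infty)$ for every $m\in M$. A collection $(\mathcal{A}_\xi)_{\xi<\omega_1}$ of subfamilies of $[M]^{<\omega}$ is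 a system of uniform families on $M$ if each $\mathcal{A}_\xi$ is $\xi$-uniform on $M$ and, for every $m\in M$ and $1\le\xi<\omega_1$, $\mathcal{A}_\xi(m)=\mathcal{A}_{\xi_m}\cap[(m,+\infty)]^{<\omega}$, where $\xi_m+1=\xi$ if $\xi$ is a successor, and $(\xi_m)_{m\in M}$ is an increasing sequence of ordinals smaller than $\xi$ with $\sup_m\xi_m=\xi$ if $\xi$ is a limit ordinal. Schreier type construction. First define families $\mathcal{B}_a\subseteq[\mathbb{N}]^{<\omega}$ for $a<\omega_1$: $\mathcal{B}_0=\{\{n\}:n\in\mathbb{N}\}$; $$\mathcal{B}_{a+1}=\Big\{s\subseteq\mathbb{N}:s=\bigcup_{i=1}^{n}s_i\text{ where }n=\min s_1,\ s_1<\dots<s_n\text{ and }s_1,\dots,s_n\in\mathcal{B}_a\Big\};$$ and for a limit countable ordinal $a$, $\mathcal{B}_a=\{s\subseteq\mathbb{N}:s\in\mathcal{B}_{a_n}\text{ with }n=\min s\}$, where $(a_n)$ is a fixed increasing sequence of ordinals smaller than $a$ with $\sup_n a_n=a$. Then set $\mathcal{A}_{\omega^a}=\mathcal{B}_a$ for all $a<\omega_1$, and complete as follows: $\mathcal{A}_0=\{\emptyset\}$; $\mathcal{A}_{\xi+1}=\{s\subseteq\mathbb{N}:s=\{n\}\cup s_1\text{ where }n\in\mathbb{N},\ \{n\}<s_1\text{ and }s_1\in\mathcal{A}_\xi\}$; and for a limit countable ordinal $\xi=\sum_{i=1}^{m}p_i\omega^{a_i}$, where $m,p_1,\dots,p_m\in\mathbb{N}$,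 $a_1>\dots>a_m>0$ are ordinals and $p\,\omega^a$ denotes the sum of $p$ copies of $\omega^a$, $$\mathcal{A}_\xi=\Big\{s\subseteq\mathbb{N}:s=\bigcup_{i=1}^{m}s_i,\ s_m<\dots<s_1,\ s_i=F_1^i\cup\dots\cup F_{p_i}^i\text{ with }F_1^i<\dots<F_{p_i}^i\text{ and }F_1^i,\dots,F_{p_i}^i\in\mathcal{B}_{a_i}\text{ for every }1\le i\le m\Big\}.$$
   Formalization: The fixed sequences (a_n) at limit ordinals a are required to have no limit ordinal among their terms; for arbitrary increasing sequences with supremum a the claim fails, since one can choose them so that B_{ω²} = B_ω. *)

(* Defs.v *)
From mathcomp Require Import all_boot all_order finmap.
From mathcomp Require Import boolp classical_sets functions cardinality wochoice.

Set Implicit Arguments.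
Unset Strict Implicit.
Unset Printing Implicit Defensive.

Local Open Scope classical_set_scope.
Local Open Scope fset_scope.

(* The countable ordinals are modelled by an arbitrary total order of type
   omega_1; up to isomorphism there is exactly one.  The elements of such an
   order are the ordinals xi < omega_1. *)
Record is_omega1 (d : Order.disp_t) (W : orderType d) : Prop := IsOmega1 {
  omega1_wo : well_order (@Order.le d W) ;
  omega1_uncountable : ~ countable [set: W] ;
  omega1_countable_below : forall x : W, countable [set y : W | (y < x)%O]
}.

(* Arithmetic on the ordinals is given by the graphs of the usual recursive
   definitions, so that no totality proof is needed to state anything. *)
Section Ordinals.
Context {d : Order.disp_t} {W : orderType d}.
Implicit Types x y z a b : W.

Definition is_zero x : Prop := forall y, (x <= y)%O.

(* [is_succ x y] : y = x + 1 *)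
Definition is_succ x y : Prop := (x < y)%O /\ forall z, (x < z)%O -> (y <= z)%O.

(* Zero is not counted as a limit. *)
Definition is_limit x : Prop := ~ is_zero x /\ ~ exists y, is_succ y x.

(* (f m)_{m in M} is an increasing sequence of ordinals smaller than x with
   supremum x; values of f outside M are irrelevant. *)
Definition increasing_to (M : set nat) (f : nat -> W) x : Prop :=
  [/\ forall i j, M i -> M j -> (i < j)%N -> (f i < f j)%O,
      forall i, M i -> (f i < x)%O
    & isLub (f @` M) x].

(* [is_add x y z] : z = x + y *)
Inductive is_add x : W -> W -> Prop :=
| is_add0 y : is_zero y -> is_add x y x
| is_addS y y' z z' :
    is_succ y y' -> is_add x y z -> is_succ z z' -> is_add x y' z'
| is_addL y (f : W -> W) z :
    is_limit y -> (forall u, (u < y)%O -> is_add x u (f u)) ->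
    isLub (f @` [set u | (u < y)%O]) z -> is_add x y z.

(* [is_osum f n z] : z = f 0 + f 1 + ... + f (n - 1), in this order *)
Inductive is_osum (f : nat -> W) : nat -> W -> Prop :=
| is_osum0 z : is_zero z -> is_osum f 0 z
| is_osumS n y z : is_osum f n y -> is_add y (f n) z -> is_osum f n.+1 z.

(* [is_mul p x z] : z is the sum of p copies of x *)
Definition is_mul (p : nat) x z : Prop := is_osum (fun=> x) p z.

(* [is_omega_pow a x] : x = omega ^ a; in the successor step,
   omega ^ (a + 1) = omega ^ a * omega = sup_p (p copies of omega ^ a). *)
Inductive is_omega_pow : W -> W -> Prop :=
| is_omega_pow0 a x : is_zero a -> is_succ a x -> is_omega_pow a x
| is_omega_powS a a' x z :
    is_succ a a' -> is_omega_pow a x ->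
    isLub [set y | exists p, is_mul p x y] z -> is_omega_pow a' z
| is_omega_powL a (f : W -> W) z :
    is_limit a -> (forall b, (b < a)%O -> is_omega_pow b (f b)) ->
    isLub (f @` [set b | (b < a)%O]) z -> is_omega_pow a z.

(* x = sum_(i < m) p_i omega ^ a_i with m and the p_i positive and
   a_0 > ... > a_(m-1) > 0; w i is omega ^ a_i and t i is p_i omega ^ a_i. *)
Definition is_cantor_form (m : nat) (p : nat -> nat) (a : nat -> W) x : Prop :=
  [/\ (0 < m)%N,
      forall i, (i < m)%N -> (0 < p i)%N,
      forall i, (i < m)%N -> ~ is_zero (a i),
      forall i j, (i < j)%N -> (j < m)%N -> (a j < a i)%O
    & exists w t : nat -> W,
        [/\ forall i, (i < m)%N -> is_omega_pow (a i) (w i),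
            forall i, (i < m)%N -> is_mul (p i) (w i) (t i)
          & is_osum t m x]].

End Ordinals.

(* N = {1, 2, 3, ...} *)
Definition posnat : set nat := [set n | (0 < n)%N].

Definition above (m : nat) : set nat := [set k | (m < k)%N].

(* [M]^{<omega} *)
Definition finsubsets (M : set nat) : set {fset nat} :=
  [set s : {fset nat} | forall k, k \in s -> M k].

Definition bigfsetU (n : nat) (s_ : nat -> {fset nat}) : {fset nat} :=
  \big[@fsetU _/fset0]_(i < n) s_ i.

(* s < t, vacuously true if s or t is empty *)
Definition fset_lt (s t : {fset nat}) : Prop :=
  forall i j, i \in s -> j \in t -> (i < j)%N.

(* n = min s; in particular s is nonempty *)
Definition is_min (s : {fset nat}) (n : nat) : Prop :=
  n \in s /\ forall k, k \in s -> (n <= k)%N.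

(* L(m), for a family L of finite subsets of M *)
Definition section (M : set nat) (L : set {fset nat}) (m : nat) :
    set {fset nat} :=
  [set s : {fset nat} | [/\ finsubsets M s, L (m |` s) & fset_lt [fset m] s]].

Section Families.
Context {d : Order.disp_t} {W : orderType d}.
Implicit Types (x z a b : W) (M : set nat) (L : set {fset nat}).

(* [is_uniform x M L] : L is x-uniform on M, where M is an infinite set of
   positive integers and L is a family of finite subsets of M. *)
Inductive is_uniform : W -> set nat -> set {fset nat} -> Prop :=
| uniform0 x M L : is_zero x -> L = [set fset0] -> is_uniform x M L
| uniformS z x M L :
    is_succ z x -> ~ L fset0 ->
    (forall m, M m -> is_uniform z (M `&` above m)%classic (section M L m)) ->
    is_uniform x M L
| uniformL (f : nat -> W) x M L :
    is_limit x -> ~ L fset0 -> increasing_to M f x ->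
    (forall m, M m -> is_uniform (f m) (M `&` above m)%classic (section M L m)) ->
    is_uniform x M L.

Record uniform_system M (A : W -> set {fset nat}) : Prop := UniformSystem {
  usys_pos : (M `<=` posnat)%classic ;
  usys_infinite : infinite_set M ;
  usys_sub : forall x, (A x `<=` finsubsets M)%classic ;
  usys_uniform : forall x, is_uniform x M (A x) ;
  usys_succ : forall z x, is_succ z x -> forall m, M m ->
    section M (A x) m = (A z `&` finsubsets (above m))%classic ;
  usys_limit : forall x, is_limit x ->
    exists2 f : nat -> W, increasing_to M f x & forall m, M m ->
      section M (A x) m = (A (f m) `&` finsubsets (above m))%classic
}.

(* A choice of the sequences (a_n)_{n >= 1} used at the limit stages a of the
   construction.  The terms a_n are required not to be limits themselves.
   Without this the result fails: let (omega)_k = k and, for a = omega^2, let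
   a_n = omega * n, where the n-th term of the sequence chosen for omega * n
   happens to be n.  Then B_(omega^2) = B_omega, a single family that cannot be
   both omega^omega-uniform and omega^(omega^2)-uniform.  Every limit has such
   a sequence: replace (a_n) by (a_n + 1). *)
Definition fundamental_system (e : W -> nat -> W) : Prop :=
  forall a, is_limit a ->
    increasing_to posnat (e a) a /\
    forall n, posnat n -> ~ is_limit (e a n).

(* [schreierB e a] is the family B_a, with e a n in the role of a_n; the blocks
   s_1 < ... < s_n are numbered from 0. *)
Inductive schreierB (e : W -> nat -> W) : W -> {fset nat} -> Prop :=
| schreierB0 a n : is_zero a -> (0 < n)%N -> schreierB e a [fset n]
| schreierBS a a' n (s_ : nat -> {fset nat}) :
    is_succ a a' -> (0 < n)%N -> is_min (s_ 0) n ->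
    (forall i j, (i < j)%N -> (j < n)%N -> fset_lt (s_ i) (s_ j)) ->
    (forall i, (i < n)%N -> schreierB e a (s_ i)) ->
    schreierB e a' (bigfsetU n s_)
| schreierBL a n s :
    is_limit a -> is_min s n -> schreierB e (e a n) s -> schreierB e a s.

(* [schreierA e x] is the family A_x. *)
Inductive schreierA (e : W -> nat -> W) : W -> {fset nat} -> Prop :=
| schreierA_pow a x s :
    is_omega_pow a x -> schreierB e a s -> schreierA e x s
| schreierA0 x : is_zero x -> schreierA e x fset0
| schreierAS z x n s :
    is_succ z x -> (0 < n)%N -> fset_lt [fset n] s ->
    schreierA e z s -> schreierA e x (n |` s)
| schreierAL x m p (a : nat -> W) (s_ : nat -> {fset nat})
    (F : nat -> nat -> {fset nat}) :
    is_limit x -> is_cantor_form m p a x ->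
    (forall i j, (i < j)%N -> (j < m)%N -> fset_lt (s_ j) (s_ i)) ->
    (forall i, (i < m)%N -> s_ i = bigfsetU (p i) (F i)) ->
    (forall i k l, (i < m)%N -> (k < l)%N -> (l < p i)%N ->
      fset_lt (F i k) (F i l)) ->
    (forall i k, (i < m)%N -> (k < p i)%N -> schreierB e (a i) (F i k)) ->
    schreierA e x (bigfsetU m s_).

End Families.

(* Main.v *)
Require Import Defs.
From mathcomp Require Import all_boot all_order finmap.
From mathcomp Require Import boolp classical_sets functions cardinality.

Set Implicit Arguments.
Unset Strict Implicit.
Unset Printing Implicit Defensive.

(** Write an ordinal as a sum of powers of omega with non-increasing exponents
    and let [l] be the list of the exponents, the last summand first, so that
    [l] is nondecreasing.  Prepending an exponent [c] to [l] adds [omega ^ c] on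
    the right of the sum ([cnf_val]), and on the side of sets it puts a block
    from B_c in front of a concatenation of blocks ([blocks]).  By existence and
    uniqueness of the Cantor normal form ([cnf_ex], [cnf_unique]) each ordinal
    [x] has one such list, and A_x consists of the concatenations of blocks along
    it ([schreierA_cnfP]).  This covers the successor, limit and power of omega
    clauses of the construction at once: a block from B_0 is a single point.

    In this description the section of A_x at [n] only affects the first
    exponent [c].  Removing its least element [n] from a set of B_c leaves a
    concatenation of blocks along a list [r] that depends on [c] and [n]:
    - if [c = 0], nothing is left;
    - if [c = b + 1], the set consists of [n] blocks from B_b, the first of which
      loses its least element: [r] is the list for [b] followed by [n - 1]
      copies of [b];
    - if [c] is a limit, the set lies in B_(c_n), and [r] is the list for [c_n].
    So the section of A_x at [n], for [x = y + omega ^ c], is A_(y + v_n) cut down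
    to sets above [n], where [v_n] is the value of [r] ([section_schreierA]).

    It remains to see that [v_n] increases to [omega ^ c] when [c > 0]
    ([remainder_increasing]).  For [c = b + 1] this follows from
    [omega ^ b * (n - 1) <= v_n < omega ^ b * n].  For [c] a limit and
    [n > 1], the term [c_n] is a successor [b + 1], which gives
    [omega ^ b <= v_n < omega ^ c_n]; and [c_m <= b] for [m < n], so that
    [v_m < omega ^ c_m <= v_n].
    This is where the assumption that the [c_n] are not limits enters: a limit
    [c_n] would make [v_n] depend on a second sequence, unrelated to the first.

    Uniformity of A_x then follows by induction on [x] from these formulas for
    the sections ([schreierA_uniform]). *)

Import Order.TTheory.
Local Open Scope order_scope.
Local Open Scope classical_set_scope.

(** * Countable ordinals *)

Section SchreierSystem.
Context {d : Order.disp_t} {W : orderType d}.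
Implicit Types x y z a b c u v w : W.

Lemma is_zero_eq x y : is_zero x -> is_zero y -> x = y.
Proof. by move=> x0 y0; apply/le_anti; rewrite x0 y0. Qed.

Lemma is_zero_nlt x y : is_zero x -> ~ y < x.
Proof. by move=> x0; rewrite ltNge x0. Qed.

Lemma is_succ_fun x y z : is_succ x y -> is_succ x z -> y = z.
Proof. by move=> [xy hy] [xz hz]; apply/le_anti; rewrite hy // hz. Qed.

Lemma is_succ_ltP x y z : is_succ x y -> (z < y) = (z <= x).
Proof.
move=> [xy hy]; apply/idP/idP => [zy|]; last by move/le_lt_trans; apply.
by rewrite leNgt; apply/negP => /hy; rewrite leNgt zy.
Qed.

Lemma is_succ_inj x y z : is_succ x z -> is_succ y z -> x = y.
Proof.
move=> xz yz; apply/le_anti.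
by rewrite -(is_succ_ltP _ yz) xz.1 -(is_succ_ltP _ xz) yz.1.
Qed.

Lemma is_succ_not_zero x y : is_succ x y -> ~ is_zero y.
Proof. by move=> [xy _] /is_zero_nlt; apply; exact: xy. Qed.

Lemma is_succ_not_limit x y : is_succ x y -> ~ is_limit y.
Proof. by move=> xy [_]; apply; exists x. Qed.

Lemma ordinal_cases x : [\/ is_zero x, exists z, is_succ z x | is_limit x].
Proof.
have [x0|xn0] := pselect (is_zero x); first by constructor 1.
have [xs|xns] := pselect (exists z, is_succ z x); first by constructor 2.
by constructor 3.
Qed.

Lemma isLub_fun (S : set W) x y : isLub S x -> isLub S y -> x = y.
Proof. by move=> [ux lx] [uy ly]; apply/le_anti; rewrite lx // ly. Qed.

Lemma isLub_below_fun (f g : W -> W) y x z :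
  (forall u, u < y -> f u = g u) -> isLub (f @` [set u | u < y]) x ->
  isLub (g @` [set u | u < y]) z -> x = z.
Proof. by move=> fg; rewrite (eq_imagel fg); exact: isLub_fun. Qed.

Lemma isLub_ltP (S : set W) x z : isLub S x ->
  z < x -> exists2 y, S y & z < y.
Proof.
move=> [ux lx] zx; apply: contrapT => nS.
suff: x <= z by rewrite leNgt zx.
apply: lx => y Sy; rewrite leNgt; apply/negP => zy.
by apply: nS; exists y.
Qed.

(** A strictly increasing sequence never attains its supremum, so the supremum
    cannot be a successor. *)
Lemma increasing_to_limit (f : nat -> W) x :
  increasing_to posnat f x -> is_limit x.
Proof.
move=> [_ fx lubx]; split=> [/is_zero_nlt|[y yx]].
  by apply; apply: (fx 1%N).
suff: x <= y by rewrite leNgt yx.1.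
by apply: lubx.2 => _ [i /fx fix_ <-]; rewrite -(is_succ_ltP _ yx).
Qed.

Context (hW : is_omega1 W).

Lemma ex_least (P : W -> Prop) :
  (exists x, P x) -> exists x, P x /\ forall y, P y -> x <= y.
Proof.
move=> [x Px].
have [|z [[zP zmin] _]] := omega1_wo hW (A := [pred y | `[<P y>]]).
  by exists x; apply/asboolP.
exists z; split; first by exact/asboolP.
by move=> y Py; apply: zmin; exact/asboolP.
Qed.

Lemma ordinal_ind (P : W -> Prop) :
  (forall x, (forall y, y < x -> P y) -> P x) -> forall x, P x.
Proof.
move=> IH x; apply: contrapT => nPx.
have [z [nPz zmin]] := @ex_least (fun y => ~ P y) (ex_intro _ x nPx).
apply/nPz/IH => y yz; apply: contrapT => /zmin; by rewrite leNgt yz.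
Qed.

(** The countably many initial segments below the elements of a countable set
    are countable, so they do not exhaust the uncountable order: countable
    sets of countable ordinals have suprema. *)
Lemma countable_lub (S : set W) : countable S -> exists z, isLub S z.
Proof.
move=> cS; apply: (@ex_least (ubound S)); apply: contrapT => nub.
apply: (omega1_uncountable hW).
suff -> : [set: W] = (\bigcup_(y in S) [set z | (z < y)%O])%classic.
  by apply: bigcup_countable => // y _; exact: omega1_countable_below.
apply/seteqP; split=> // z _; apply: contrapT => nz; apply: nub.
exists z => y Sy; rewrite leNgt; apply/negP => zy.
by apply: nz; exists y.
Qed.

Lemma lub_below_ex y (f : W -> W) :
  exists z, isLub (f @` [set u | u < y]) z.
Proof.
apply: countable_lub.
exact: card_le_trans (card_image_le _ _) (omega1_countable_below hW y).
Qed.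

Lemma zero_ex : exists x, is_zero x.
Proof.
have [z [_ zub]] := countable_lub (@countable0 W).
by exists z => y; apply: zub => ?.
Qed.

Lemma succ_ex x : exists y, is_succ x y.
Proof.
apply: (@ex_least (fun y => x < y)); apply: contrapT => nx.
have nlt y : y <= x by rewrite leNgt; apply/negP => xy; apply: nx; exists y.
apply: (omega1_uncountable hW).
suff -> : [set: W] = ([set y | (y < x)%O] `|` [set x])%classic.
  rewrite -bigcup2E; apply: bigcup_countable => // -[|[|i]] _ /=.
  - exact: omega1_countable_below.
  - exact: countable1.
  - exact: countable0.
apply/seteqP; split=> // y _ /=; have := nlt y.
by rewrite le_eqVlt => /orP[/eqP ->|]; [right|left].
Qed.

Definition ozero : W := projT1 (cid zero_ex).
Definition osucc x : W := projT1 (cid (succ_ex x)).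

Lemma ozeroP : is_zero ozero. Proof. exact: projT2 (cid zero_ex). Qed.

Lemma osuccP x : is_succ x (osucc x). Proof. exact: projT2 (cid (succ_ex x)). Qed.

Lemma ltS x : x < osucc x. Proof. exact: (osuccP x).1. Qed.

Lemma ltSP x y : (x < osucc y) = (x <= y).
Proof. exact: is_succ_ltP (osuccP y). Qed.

Lemma osucc_leP x y : (osucc x <= y) = (x < y).
Proof. by rewrite leNgt ltSP -ltNge. Qed.

Lemma is_succE x y : is_succ x y -> y = osucc x.
Proof. by move=> xy; exact: is_succ_fun xy (osuccP x). Qed.

Lemma limit_succ_lt x y : is_limit x -> y < x -> osucc y < x.
Proof.
move=> [_ ns] yx; rewrite lt_neqAle osucc_leP yx andbT.
by apply/eqP => E; apply: ns; exists y; rewrite -E; exact: osuccP.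
Qed.

Lemma limit_gt0 x : is_limit x -> ozero < x.
Proof.
move=> [n0 _]; rewrite lt_neqAle ozeroP andbT; apply/eqP => E.
by apply: n0; rewrite -E; exact: ozeroP.
Qed.

(** * Addition of ordinals *)

(** The graph of addition defines a function: the three clauses for the second
    summand exclude each other. *)
Lemma is_add_fun x y z z' : is_add x y z -> is_add x y z' -> z = z'.
Proof.
move: z z'; elim/ordinal_ind: y => y IH z z' H H'.
inversion H as [y0 y0z|u y0 v v' uy uv vv'|y0 f z0 ly hf lubf]; subst;
inversion H' as [y1 y1z|u1 y1 v1 v1' uy1 uv1 vv1'|y1 f1 z1 ly1 hf1 lubf1]; subst.
- by [].
- by case: (is_succ_not_zero uy1).
- by case: ly1.
- by case: (is_succ_not_zero uy).
- have E := is_succ_inj uy uy1; subst u1.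
  have E := IH _ uy.1 _ _ uv uv1; subst v1.
  exact: is_succ_fun vv' vv1'.
- by case: (is_succ_not_limit uy).
- by case: ly.
- by case: (is_succ_not_limit uy1).
- apply: isLub_below_fun lubf lubf1 => u uy; exact: IH (hf _ uy) (hf1 _ uy).
Qed.

(** Only countably many values lie below a limit stage, so their supremum
    exists. *)
Lemma is_add_ex x y : exists z, is_add x y z.
Proof.
elim/ordinal_ind: y => y IH.
have [y0|[u uy]|ly] := ordinal_cases y.
- by exists x; exact: is_add0.
- have [v uv] := IH _ uy.1.
  by exists (osucc v); exact: is_addS uy uv (osuccP v).
- have /choice[f hf] : forall u, exists z, u < y -> is_add x u z.
    move=> u; have [uy|nuy] := boolP (u < y); last by exists x.
    by have [z ?] := IH _ uy; exists z.
  have [z zlub] := lub_below_ex y f.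
  by exists z; exact: is_addL ly hf zlub.
Qed.

Definition oadd x y : W := projT1 (cid (is_add_ex x y)).

Lemma oaddP x y : is_add x y (oadd x y).
Proof. exact: projT2 (cid (is_add_ex x y)). Qed.

Lemma is_addE x y z : is_add x y z -> z = oadd x y.
Proof. by move=> H; exact: is_add_fun H (oaddP x y). Qed.

Lemma oadd0 x : oadd x ozero = x.
Proof. by apply/esym/is_addE/is_add0; exact: ozeroP. Qed.

Lemma oaddS x y : oadd x (osucc y) = osucc (oadd x y).
Proof. by apply/esym/is_addE; exact: is_addS (osuccP y) (oaddP x y) (osuccP _). Qed.

Lemma oaddL x y : is_limit y -> isLub (oadd x @` [set u | u < y]) (oadd x y).
Proof.
move=> ly; have [z zlub] := lub_below_ex y (oadd x).
by rewrite -(is_addE (is_addL ly (fun u _ => oaddP x u) zlub)).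
Qed.

Lemma oadd_lt x u y : u < y -> oadd x u < oadd x y.
Proof.
elim/ordinal_ind: y => y IH uy.
have [y0|[z zy]|ly] := ordinal_cases y.
- by case: (is_zero_nlt y0 uy).
- have Ey := is_succE zy; rewrite Ey oaddS ltSP.
  move: uy; rewrite (is_succ_ltP _ zy) le_eqVlt => /orP[/eqP -> //|uz].
  exact/ltW/IH/uz/zy.1.
- apply: lt_le_trans (ltS _) _; rewrite -oaddS.
  by apply: (oaddL x ly).1; exists (osucc u) => //; exact: limit_succ_lt.
Qed.

Lemma oadd_ltE x : {mono oadd x : u y / u < y}.
Proof. by apply: leW_mono; apply: le_mono => u y; exact: oadd_lt. Qed.

Lemma oadd_leE x : {mono oadd x : u y / u <= y}.
Proof. by apply: le_mono => u y; exact: oadd_lt. Qed.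

Lemma oadd_inj x : injective (oadd x).
Proof. by move=> u v /eqP; rewrite eq_le !oadd_leE -eq_le => /eqP. Qed.

Lemma oadd_ler x y : x <= oadd x y.
Proof. by rewrite -{1}(oadd0 x) oadd_leE; exact: ozeroP. Qed.

Lemma le_of_strict (f : W -> W) :
  {homo f : x y / x < y} -> forall x, x <= f x.
Proof.
move=> f_lt; elim/ordinal_ind => x IH; rewrite leNgt; apply/negP => fx.
by have := IH _ fx; rewrite leNgt f_lt.
Qed.

Lemma oadd_lel x y : y <= oadd x y.
Proof. by apply: (@le_of_strict (oadd x)) => u v; exact: oadd_lt. Qed.

(** The least [u] with [w <= x + u] works, by continuity of addition. *)
Lemma oadd_sub x w : x <= w -> exists u, w = oadd x u.
Proof.
move=> xw.
have [u [wu umin]] := @ex_least (fun u => w <= oadd x u)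
  (ex_intro _ w (oadd_lel x w)).
exists u; apply/le_anti; rewrite wu /=.
have lt_u v : v < u -> oadd x v < w.
  by move=> vu; rewrite ltNge; apply/negP => /umin; rewrite leNgt vu.
have [u0|[v vu]|lu] := ordinal_cases u.
- by rewrite (is_zero_eq u0 ozeroP) oadd0.
- by rewrite (is_succE vu) oaddS osucc_leP lt_u // vu.1.
- by apply: (oaddL x lu).2 => _ [v vu <-]; apply/ltW/lt_u.
Qed.

(** The initial segment below [x + y] is the one below [x] followed by a copy
    of the one below [y]; identities between sums are derived from this. *)
Lemma lt_oaddP x y w :
  w < oadd x y <-> w < x \/ exists2 u, u < y & w = oadd x u.
Proof.
split=> [wxy|[wx|[u uy ->]]]; last by rewrite oadd_ltE.
- have [|xw] := ltP w x; [by left|right].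
  by have [u E] := oadd_sub xw; exists u => //; rewrite -(oadd_ltE x) -E.
- exact: lt_le_trans wx (oadd_ler _ _).
Qed.

Lemma eq_of_lt x y : (forall w, w < x <-> w < y) -> x = y.
Proof.
move=> H; apply/le_anti/andP; split; rewrite leNgt; apply/negP => /H;
  by rewrite ltxx.
Qed.

Lemma oaddA x y z : oadd (oadd x y) z = oadd x (oadd y z).
Proof.
elim/ordinal_ind: z => z IH; apply: eq_of_lt => w; split.
- case/lt_oaddP => [/lt_oaddP[wx|[u uy ->]]|[u uz ->]].
  + by apply/lt_oaddP; left.
  + by rewrite oadd_ltE; exact: lt_le_trans uy (oadd_ler _ _).
  + by rewrite IH // !oadd_ltE.
- case/lt_oaddP => [wx|[v /lt_oaddP[vy|[u uz ->]] ->]].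
  + exact: lt_le_trans wx (le_trans (oadd_ler x y) (oadd_ler _ _)).
  + apply: lt_le_trans (oadd_ler _ _); by rewrite oadd_ltE.
  + by rewrite -IH // oadd_ltE.
Qed.

Lemma add0o x : oadd ozero x = x.
Proof.
elim/ordinal_ind: x => x IH; apply: eq_of_lt => w; split.
- by case/lt_oaddP => [/(is_zero_nlt ozeroP)//|[u ux ->]]; rewrite IH.
- by move=> wx; rewrite -(IH _ wx) oadd_ltE.
Qed.

Lemma oadd_lel2 x y z : x <= y -> oadd x z <= oadd y z.
Proof.
move=> xy; elim/ordinal_ind: z => z IH; rewrite leNgt; apply/negP.
case/lt_oaddP => [|[u uz E]].
  by rewrite ltNge (le_trans xy (oadd_ler _ _)).
by have := IH _ uz; rewrite -E leNgt oadd_ltE uz.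
Qed.

(** An ordinal below [x + y] lies below [x] or is [x + u] with [u < y], and then
    some [f i] exceeds [u]; so it is not an upper bound. *)
Lemma oadd_increasing_to x (f : nat -> W) y :
  increasing_to posnat f y ->
  increasing_to posnat (fun n => oadd x (f n)) (oadd x y).
Proof.
move=> [f_incr f_lt f_lub]; split.
- by move=> i j i0 j0 ij; rewrite oadd_ltE; exact: f_incr.
- by move=> i i0; rewrite oadd_ltE; exact: f_lt.
- split=> [_ [i i0 <-]|z zub]; first by rewrite oadd_leE ltW // f_lt.
  rewrite leNgt; apply/negP => /lt_oaddP[zx|[u uy E]].
    have /zub : ((fun n => oadd x (f n)) @` posnat) (oadd x (f 1%N)) by exists 1%N.
    by rewrite leNgt (lt_le_trans zx (oadd_ler _ _)).
  have [_ [i i0 <-] ui] := isLub_ltP f_lub uy.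
  have /zub : ((fun n => oadd x (f n)) @` posnat) (oadd x (f i)) by exists i.
  by rewrite E leNgt oadd_ltE ui.
Qed.

(** * Finite multiples and powers of omega *)

Definition omul p x : W := iter p (fun z => oadd z x) ozero.

Lemma is_osumE f n z : is_osum f n z ->
  z = iteri n (fun i v => oadd v (f i)) ozero.
Proof.
elim: n z => [|n IH] z H; inversion H as [z0 z00|n0 y z0 H1 H2]; subst.
  exact: is_zero_eq z00 ozeroP.
by rewrite /= -(IH _ H1); exact: is_addE.
Qed.

Lemma is_osum_ex f n : is_osum f n (iteri n (fun i v => oadd v (f i)) ozero).
Proof.
elim: n => [|n IH]; first by apply: is_osum0; exact: ozeroP.
exact: is_osumS IH (oaddP _ _).
Qed.

Lemma iteri_omul p x : iteri p (fun=> fun v => oadd v x) ozero = omul p x.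
Proof. by elim: p => //= p ->. Qed.

Lemma is_mulP p x z : is_mul p x z <-> z = omul p x.
Proof.
rewrite -iteri_omul; split=> [|->]; first exact: is_osumE.
exact: (is_osum_ex (fun=> x)).
Qed.

Lemma omulS p x : omul p.+1 x = oadd (omul p x) x. Proof. by []. Qed.

Lemma omul_add p q x : omul (p + q) x = oadd (omul p x) (omul q x).
Proof.
elim: q => [|q IH]; first by rewrite addn0 oadd0.
by rewrite addnS !omulS IH oaddA.
Qed.

Lemma omul1 x : omul 1 x = x. Proof. by rewrite omulS add0o. Qed.

Lemma omul_le p q x : (p <= q)%N -> omul p x <= omul q x.
Proof. by move=> pq; rewrite -(subnKC pq) omul_add oadd_ler. Qed.

Lemma is_omega_pow_fun a x y : is_omega_pow a x -> is_omega_pow a y -> x = y.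
Proof.
move: x y; elim/ordinal_ind: a => a IH x y H H'.
inversion H as [a0 x0 a00 sx|b a0 x0 z ba bx lubz|a0 f z la hf lubf]; subst;
inversion H' as [a1 x1 a10 sx1|b1 a1 x1 z1 ba1 bx1 lubz1|a1 f1 z1 la1 hf1 lubf1];
  subst.
- exact: is_succ_fun sx sx1.
- by case: (is_succ_not_zero ba1).
- by case: la1.
- by case: (is_succ_not_zero ba).
- have E := is_succ_inj ba ba1; subst b1.
  have E := IH _ ba.1 _ _ bx bx1; subst x1.
  exact: isLub_fun lubz lubz1.
- by case: (is_succ_not_limit ba).
- by case: la.
- by case: (is_succ_not_limit ba1).
- apply: isLub_below_fun lubf lubf1 => u ua; exact: IH (hf _ ua) (hf1 _ ua).
Qed.

Lemma omul_lub_ex x : exists z, isLub [set y | exists p, is_mul p x y] z.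
Proof.
apply: countable_lub.
suff -> : [set y | exists p, is_mul p x y] = (fun p => omul p x) @` [set: nat].
  exact: card_image_le.
by apply/seteqP; split=> y [p];
  [move/is_mulP=> ->; exists p|move=> _ <-; exists p; exact/is_mulP].
Qed.

Lemma is_omega_pow_ex a : exists x, is_omega_pow a x.
Proof.
elim/ordinal_ind: a => a IH.
have [a0|[b ba]|la] := ordinal_cases a.
- by exists (osucc a); exact: is_omega_pow0 a0 (osuccP a).
- have [x bx] := IH _ ba.1; have [z zlub] := omul_lub_ex x.
  by exists z; exact: is_omega_powS ba bx zlub.
- have /choice[f hf] : forall u, exists z, u < a -> is_omega_pow u z.
    move=> u; have [ua|nua] := boolP (u < a); last by exists a.
    by have [z ?] := IH _ ua; exists z.
  have [z zlub] := lub_below_ex a f.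
  by exists z; exact: is_omega_powL la hf zlub.
Qed.

Definition opow a : W := projT1 (cid (is_omega_pow_ex a)).

Lemma opowP a : is_omega_pow a (opow a).
Proof. exact: projT2 (cid (is_omega_pow_ex a)). Qed.

Lemma is_omega_powE a x : is_omega_pow a x -> x = opow a.
Proof. by move=> H; exact: is_omega_pow_fun H (opowP a). Qed.

Lemma opow0 : opow ozero = osucc ozero.
Proof. by apply/esym/is_omega_powE/is_omega_pow0; [exact: ozeroP|exact: osuccP]. Qed.

Lemma opow_succ b c : is_succ b c ->
  isLub ((fun p => omul p (opow b)) @` [set: nat]) (opow c).
Proof.
move=> bc; have [z zlub] := omul_lub_ex (opow b).
rewrite -(is_omega_powE (is_omega_powS bc (opowP b) zlub)).
suff -> : (fun p => omul p (opow b)) @` [set: nat]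
    = [set y | exists p, is_mul p (opow b) y] by [].
by apply/seteqP; split=> y [p];
  [move=> _ <-; exists p; exact/is_mulP|move/is_mulP=> ->; exists p].
Qed.

Lemma opow_limit c : is_limit c -> isLub (opow @` [set u | u < c]) (opow c).
Proof.
move=> lc; have [z zlub] := lub_below_ex c opow.
by rewrite -(is_omega_powE (is_omega_powL lc (fun u _ => opowP u) zlub)).
Qed.

Lemma opow_gt0 a : ozero < opow a.
Proof.
elim/ordinal_ind: a => a IH.
have [a0|[b ba]|la] := ordinal_cases a.
- by rewrite (is_zero_eq a0 ozeroP) opow0 ltS.
- apply: lt_le_trans (IH _ ba.1) _; apply: (opow_succ ba).1.
  by exists 1%N => //; exact: omul1.
- have a0 := limit_gt0 la; apply: lt_le_trans (IH _ a0) _.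
  by apply: (opow_limit la).1; exists ozero.
Qed.

Lemma omul_opow_lt p b c : is_succ b c -> omul p (opow b) < opow c.
Proof.
move=> bc; apply: (@lt_le_trans _ _ (omul p.+1 (opow b))).
  by rewrite omulS -{1}(oadd0 (omul p _)) oadd_ltE; exact: opow_gt0.
by apply: (opow_succ bc).1; exists p.+1.
Qed.

Lemma opow_lt : {homo opow : a b / a < b}.
Proof.
move=> a b; elim/ordinal_ind: b => b IH ab.
have [b0|[c cb]|lb] := ordinal_cases b.
- by case: (is_zero_nlt b0 ab).
- apply: le_lt_trans (omul_opow_lt 1 cb); rewrite omul1.
  move: ab; rewrite (is_succ_ltP _ cb) le_eqVlt => /orP[/eqP -> //|ac].
  exact/ltW/IH/ac/cb.1.
- have sb := limit_succ_lt lb ab.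
  apply: lt_le_trans (IH _ sb (ltS a)) _.
  by apply: (opow_limit lb).1; exists (osucc a).
Qed.

Lemma opow_leE : {mono opow : a b / a <= b}.
Proof. exact: le_mono opow_lt. Qed.

Lemma opow_ltE : {mono opow : a b / a < b}.
Proof. exact: leW_mono opow_leE. Qed.

(** Powers of omega are additively indecomposable: for a successor exponent, a
    sum of two finite multiples of [omega ^ b] is again a finite multiple. *)
Lemma oadd_lt_opow a x y : x < opow a -> y < opow a -> oadd x y < opow a.
Proof.
move: x y; elim/ordinal_ind: a => a IH x y xa ya.
have [a0|[b ba]|la] := ordinal_cases a.
- move: xa ya; rewrite (is_zero_eq a0 ozeroP) opow0 !ltSP => xa ya.
  by rewrite (le_anti (x := y) (y := ozero)) ?ya ?ozeroP // oadd0.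
- have [_ [p _ <-] xp] := isLub_ltP (opow_succ ba) xa.
  have [_ [q _ <-] yq] := isLub_ltP (opow_succ ba) ya.
  apply: le_lt_trans (omul_opow_lt (p + q) ba); rewrite omul_add.
  apply: le_trans (oadd_lel2 _ (ltW xp)) _; by rewrite oadd_leE ltW.
- have [_ [b ba <-] xb] := isLub_ltP (opow_limit la) xa.
  have [_ [c ca <-] yc] := isLub_ltP (opow_limit la) ya.
  have ma : Order.max b c < a by rewrite gt_max ba.
  apply: lt_trans (opow_lt ma); apply: IH => //.
    by apply: lt_le_trans xb _; rewrite opow_leE le_max lexx.
  by apply: lt_le_trans yc _; rewrite opow_leE le_max lexx orbT.
Qed.

(** * Cantor normal forms *)

(** The head of the list is the exponent of the last summand, as this is the
    summand that successor steps and sections change. *)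
Fixpoint cnf_val (l : seq W) : W :=
  if l is c :: l' then oadd (cnf_val l') (opow c) else ozero.

Lemma cnf_val_cat l1 l2 : cnf_val (l1 ++ l2) = oadd (cnf_val l2) (cnf_val l1).
Proof. by elim: l1 => [|c l1 IH] /=; rewrite ?oadd0 // IH oaddA. Qed.

Lemma cnf_val_nseq k b : cnf_val (nseq k b) = omul k (opow b).
Proof. by elim: k => //= k ->. Qed.

Lemma cnf_val_lt_opow a l : all (fun c => c < a) l -> cnf_val l < opow a.
Proof.
elim: l => [_|c l IH] /=; first exact: opow_gt0.
by case/andP=> ca /IH la; apply: oadd_lt_opow => //; rewrite opow_ltE.
Qed.

Lemma opow_le_cnf_val c l : c \in l -> opow c <= cnf_val l.
Proof.
elim: l => // b l IH; rewrite inE /= => /orP[/eqP ->|/IH cl].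
  exact: oadd_lel.
exact: le_trans cl (oadd_ler _ _).
Qed.

Lemma sorted_cat_le (l1 l2 : seq W) :
  sorted <=%O (l1 ++ l2) =
  [&& allrel <=%O l1 l2, sorted <=%O l1 & sorted <=%O l2].
Proof. by rewrite !le_sorted_pairwise pairwise_cat. Qed.

Lemma sorted_nseq_le k (b : W) : sorted <=%O (nseq k b).
Proof. by elim: k => //= -[|k] //= ->; rewrite lexx. Qed.

Lemma sorted_rcons_le (l : seq W) c :
  sorted <=%O (rcons l c) = all (fun b => b <= c) l && sorted <=%O l.
Proof. by rewrite -cats1 sorted_cat_le allrel1r /= andbT. Qed.

(** Split off from [x] the largest power [omega ^ b] below it.  The rest is
    smaller than [x], as otherwise [x] would absorb every multiple of [omega ^ b]
    and reach [omega ^ (b + 1)]; and by the choice of [b] its exponents are at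
    most [b]. *)
Lemma cnf_ex x : exists2 l, sorted <=%O l & cnf_val l = x.
Proof.
elim/ordinal_ind: x => x IH.
have [x0|xn0] := pselect (is_zero x).
  by exists [::] => //=; exact: is_zero_eq ozeroP x0.
have x_gt0 : ozero < x.
  rewrite lt_neqAle ozeroP andbT; apply/eqP => E.
  by apply: xn0; rewrite -E; exact: ozeroP.
have [c [xc cmin]] : exists c, x < opow c /\ forall b, x < opow b -> c <= b.
  apply: (@ex_least (fun c => x < opow c)).
  by exists (osucc x); apply: lt_le_trans (ltS x) (le_of_strict opow_lt _).
have lt_c b : b < c -> opow b <= x.
  by move=> bc; rewrite leNgt; apply/negP => /cmin; rewrite leNgt bc.
have [b bc] : exists b, is_succ b c.
  have [c0|//|lc] := ordinal_cases c.
    by move: xc; rewrite (is_zero_eq c0 ozeroP) opow0 ltSP leNgt x_gt0.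
  have [_ [b bc <-] xb] := isLub_ltP (opow_limit lc) xc.
  by move: (lt_c _ bc); rewrite leNgt xb.
have [y Ey] := oadd_sub (lt_c b bc.1).
have yx : y < x.
  rewrite lt_neqAle {2}Ey oadd_lel andbT; apply/eqP => yE; subst y.
  have mul_le p : omul p (opow b) <= x.
    elim: p => [|p IHp]; first exact: ozeroP.
    by rewrite -add1n omul_add omul1 Ey oadd_leE.
  have : opow c <= x by apply: (opow_succ bc).2 => _ [p _ <-].
  by rewrite leNgt xc.
have [l sl vl] := IH y yx.
exists (rcons l b); last by rewrite -cats1 cnf_val_cat /= add0o vl.
rewrite sorted_rcons_le sl andbT; apply/allP => a al.
rewrite -(is_succ_ltP _ bc) -opow_ltE; apply: le_lt_trans xc.
by apply: le_trans (opow_le_cnf_val al) _; rewrite vl ltW.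
Qed.

Lemma cnf_rcons_lt l c :
  sorted <=%O (rcons l c) -> cnf_val (rcons l c) < opow (osucc c).
Proof.
rewrite sorted_rcons_le => /andP[lc _]; apply: cnf_val_lt_opow.
rewrite all_rcons ltS; apply: sub_all lc => b; by rewrite ltSP.
Qed.

(** The value determines the largest exponent [c], since it lies between
    [omega ^ c] and [omega ^ (c + 1)]; then cancel [omega ^ c] on the left. *)
Lemma cnf_unique l l' :
  sorted <=%O l -> sorted <=%O l' -> cnf_val l = cnf_val l' -> l = l'.
Proof.
have rcons_gt0 k c : ozero < cnf_val (rcons k c).
  apply: lt_le_trans (opow_gt0 c) _; apply: opow_le_cnf_val.
  by rewrite mem_rcons mem_head.
have last_le k c k' c' : sorted <=%O (rcons k' c') ->
    cnf_val (rcons k c) = cnf_val (rcons k' c') -> c <= c'.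
  move=> s' E; rewrite -ltSP -opow_ltE; apply: le_lt_trans (cnf_rcons_lt s').
  by rewrite -E; apply: opow_le_cnf_val; rewrite mem_rcons mem_head.
elim/last_ind: l l' => [|l c IH] l'.
  by case/lastP: l' => // l' c _ _ E; move: (rcons_gt0 l' c); rewrite -E ltxx.
case/lastP: l' => [_ _ E|l' c' sl sl' E].
  by move: (rcons_gt0 l c); rewrite E ltxx.
have Ec : c = c'.
  by apply/le_anti; rewrite (last_le _ _ _ _ sl' E) (last_le _ _ _ _ sl (esym E)).
subst c'; congr (rcons _ c).
move: E sl sl'; rewrite !sorted_rcons_le -!cats1 !cnf_val_cat /= !add0o.
by move=> /oadd_inj E /andP[_ sl] /andP[_ sl']; exact: IH.
Qed.

(** * Concatenations of blocks *)

Local Open Scope fset_scope.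
Implicit Types (s t G : {fset nat}) (k n : nat) (l r : seq W).

Lemma in_bigfsetU n (s_ : nat -> {fset nat}) k :
  k \in bigfsetU n s_ <-> exists2 i, (i < n)%N & k \in s_ i.
Proof.
rewrite /bigfsetU; elim: n => [|n IH].
  by rewrite big_ord0 inE; split=> // -[].
rewrite big_ord_recr /= inE; split.
  case/orP=> [/IH[i i_n ki]|kn]; last by exists n.
  by exists i => //; exact: ltnW.
case=> i; rewrite ltnS leq_eqVlt => /orP[/eqP -> ->|i_n ki]; first by rewrite orbT.
by apply/orP; left; apply/IH; exists i.
Qed.

Lemma fset_ltUl s s' t : fset_lt (s `|` s') t <-> fset_lt s t /\ fset_lt s' t.
Proof.
split=> [H|[H H'] i j].
  by split=> i j is_ jt; apply: H; rewrite // inE is_ ?orbT.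
by rewrite inE => /orP[]; [exact: H|exact: H'].
Qed.

Lemma fset_ltUr s t t' : fset_lt s (t `|` t') <-> fset_lt s t /\ fset_lt s t'.
Proof.
split=> [H|[H H'] i j is_].
  by split=> i j is_ jt; apply: H; rewrite // inE jt ?orbT.
by rewrite inE => /orP[]; [exact: H|exact: H'].
Qed.

Lemma fset_lt_bigr n (s_ : nat -> {fset nat}) t :
  fset_lt t (bigfsetU n s_) <-> forall i, (i < n)%N -> fset_lt t (s_ i).
Proof.
split=> [H i i_n j k jt ki|H j k jt /in_bigfsetU[i i_n ki]]; last exact: H ki.
by apply: H jt _; apply/in_bigfsetU; exists i.
Qed.

Lemma is_min_fun s n n' : is_min s n -> is_min s n' -> n = n'.
Proof.
by move=> [ns nmin] [ns' nmin']; apply/eqP; rewrite eqn_leq nmin // nmin'.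
Qed.

Lemma is_min_consl n t : fset_lt [fset n] t -> is_min (n |` t) n.
Proof.
move=> nt; split=> [|k]; rewrite !inE ?eqxx // => /orP[/eqP -> //|kt].
by apply/ltnW/nt => //; rewrite inE.
Qed.

Lemma bigfsetU_recl n (s_ : nat -> {fset nat}) :
  bigfsetU n.+1 s_ = s_ 0%N `|` bigfsetU n (s_ \o S).
Proof. by rewrite /bigfsetU big_ord_recl. Qed.

Lemma bigfsetU_recr n (s_ : nat -> {fset nat}) :
  bigfsetU n.+1 s_ = bigfsetU n s_ `|` s_ n.
Proof. by rewrite /bigfsetU big_ord_recr. Qed.

Lemma eq_bigfsetU n (s_ s_' : nat -> {fset nat}) :
  (forall i, (i < n)%N -> s_ i = s_' i) -> bigfsetU n s_ = bigfsetU n s_'.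
Proof. by move=> H; apply: eq_bigr => i _; apply: H. Qed.

Context (e : W -> nat -> W).

Lemma schreierB_ex_min c s : schreierB e c s -> exists n, is_min s n.
Proof.
move=> Bs; suff [k ks] : exists k, k \in s.
  have ex : exists k, k \in s by exists k.
  by exists (ex_minn ex); case: ex_minnP.
elim: Bs => {c s} [a n _ _|a a' n s_ _ n0 [n_s _] _ _ _|a n s _ _ _ //].
  by exists n; rewrite inE.
by exists n; apply/in_bigfsetU; exists 0%N.
Qed.

Lemma schreierB_pos c s : schreierB e c s -> finsubsets posnat s.
Proof.
elim=> {c s} [a n _ n0|a a' n s_ _ _ _ _ _ IH|//] k.
  by rewrite inE => /eqP ->.
by case/in_bigfsetU => i i_n; exact: IH.
Qed.

Lemma schreierB_zeroP c s : is_zero c ->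
  schreierB e c s <-> exists2 n, (0 < n)%N & s = [fset n].
Proof.
move=> c0; split=> [H|[n n0 ->]]; last exact: schreierB0.
inversion H as [a n a0 n0|a a' n s_ aa'|a n s' la]; subst.
- by exists n.
- by case: (is_succ_not_zero aa').
- by case: la.
Qed.

Lemma schreierB_limitP c s n : is_limit c -> is_min s n ->
  schreierB e c s <-> schreierB e (e c n) s.
Proof.
move=> lc sn; split=> [H|]; last exact: schreierBL.
inversion H as [a k a0 k0|a a' k s_ aa'|a k s' la sk]; subst.
- by case: lc.
- by case: (is_succ_not_limit aa').
- by rewrite (is_min_fun sn sk).
Qed.

(** The smallest block comes from the head of the list, that is, from the last
    summand of the ordinal. *)
Fixpoint blocks l s : Prop :=
  if l is c :: l' then
    exists G t, [/\ schreierB e c G, blocks l' t, fset_lt G t & s = G `|` t]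
  else s = fset0.

Lemma blocks_pos l s : blocks l s -> finsubsets posnat s.
Proof.
elim: l s => [|c l IH] s /=; first by move=> -> k; rewrite inE.
move=> [G [t [BG Dt _ ->]]] k; rewrite inE => /orP[]; last exact: IH.
exact: schreierB_pos BG k.
Qed.

Lemma blocks_cat l1 l2 s : blocks (l1 ++ l2) s <->
  exists s1 s2, [/\ blocks l1 s1, blocks l2 s2, fset_lt s1 s2 & s = s1 `|` s2].
Proof.
elim: l1 s => [|c l1 IH] s /=.
  split=> [H|[s1 [s2 [-> H2 _ ->]]]]; last by rewrite fset0U.
  by exists fset0, s; split=> //; rewrite ?fset0U // => i j; rewrite inE.
split.
- move=> [G [t [BG /IH[s1 [s2 [H1 H2 s12 ->]]]]]] /fset_ltUr[Gs1 Gs2] ->.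
  exists (G `|` s1), s2; split=> //; rewrite ?fsetUA //; last exact/fset_ltUl.
  by exists G, s1.
- move=> [_ [s2 [[G [s1 [BG H1 Gs1 ->]]] H2 /fset_ltUl[Gs2 s12] ->]]].
  exists G, (s1 `|` s2); split=> //; rewrite ?fsetUA //; last exact/fset_ltUr.
  by apply/IH; exists s1, s2.
Qed.

Lemma blocks_nseq k b s : blocks (nseq k b) s <->
  exists F, [/\ forall i j, (i < j)%N -> (j < k)%N -> fset_lt (F i) (F j),
                forall i, (i < k)%N -> schreierB e b (F i)
              & s = bigfsetU k F].
Proof.
elim: k s => [|k IH] s /=.
  rewrite /bigfsetU; split=> [->|[F [_ _ ->]]]; last by rewrite big_ord0.
  by exists (fun=> fset0); split=> //; rewrite big_ord0.
split=> [[G [t [BG /IH[F [F_lt BF ->]]]]]|[F [F_lt BF ->]]].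
- move=> /fset_lt_bigr GF ->.
  exists (fun i => if i is i'.+1 then F i' else G); split.
  + by move=> [|i] [|j] //=; rewrite !ltnS => ij jk; [exact: GF|exact: F_lt].
  + by move=> [|i] //=; rewrite ltnS; exact: BF.
  + by rewrite bigfsetU_recl.
- exists (F 0%N), (bigfsetU k (F \o S)); split=> //.
  + exact: BF.
  + apply/IH; exists (F \o S); split=> // [i j ij jk|i ik]; last exact: BF.
    exact: F_lt.
  + by apply/fset_lt_bigr => i ik; exact: F_lt.
  + by rewrite bigfsetU_recl.
Qed.

(** The number of blocks of a set of B_(b + 1) is the least element of its first
    block, which is the least element of the whole set because blocks are
    nonempty. *)
Lemma schreierB_succP b c s n : is_succ b c -> is_min s n ->
  schreierB e c s <-> blocks (nseq n b) s.
Proof.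
move=> bc sn; split=> [H|H].
- inversion H as [a k a0 k0|a a' k s_ aa' k0 ks s_lt Bs_|a k s' la]; subst.
  + by case: (is_succ_not_zero bc).
  + have E := is_succ_inj bc aa'; subst a.
    have -> : n = k.
      apply: is_min_fun sn _; split=> [|j /in_bigfsetU[i ik ji]].
        by apply/in_bigfsetU; exists 0%N => //; exact: ks.1.
      case: i ik ji => [|i] ik ji; first exact: ks.2.
      exact/ltnW/(s_lt 0%N i.+1 _ ik)/ji/ks.1.
    by apply/blocks_nseq; exists s_.
  + by case: (is_succ_not_limit bc).
- have n0 := blocks_pos H sn.1.
  have /blocks_nseq[F [F_lt BF Es]] := H; subst s.
  apply: (schreierBS bc n0) => //; split=> [|j jF]; last first.
    by apply: sn.2; apply/in_bigfsetU; exists 0%N.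
  have /in_bigfsetU[[|i] i_n n_i] := sn.1; first by [].
  have [g [gF _]] := schreierB_ex_min (BF _ n0).
  have /sn.2 : g \in bigfsetU n F by apply/in_bigfsetU; exists 0%N.
  by rewrite leqNgt (F_lt 0%N i.+1).
Qed.

(** * Sections of families of blocks *)

(** The section of B_c at [n] consists of the concatenations along [r], cut down
    to sets above [n]. *)
Definition block_section n c r := forall t,
  fset_lt [fset n] t -> schreierB e c (n |` t) <-> blocks r t.

(** The point [n] below [t] is in the first block, because that block is nonempty
    and the other blocks lie above it. *)
Lemma blocks_section n c r l t : block_section n c r -> fset_lt [fset n] t ->
  blocks (c :: l) (n |` t) <-> blocks (r ++ l) t.
Proof.
move=> Hr nt; rewrite blocks_cat; split.
- move=> [G [s [BG Ds Gs E]]].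
  have min_n := is_min_consl nt.
  have nG : n \in G.
    have : n \in G `|` s by rewrite -E; exact: min_n.1.
    rewrite inE => /orP[//|ns].
    have [g [gG _]] := schreierB_ex_min BG.
    have : (n <= g)%N by apply: min_n.2; rewrite E inE gG.
    by rewrite leqNgt Gs.
  have EG : G = n |` (G `\ n) by rewrite fsetD1K.
  have nG' : fset_lt [fset n] (G `\ n).
    move=> i j; rewrite !inE => /eqP -> /andP[jn jG].
    rewrite ltn_neqAle eq_sym jn; apply: min_n.2; by rewrite E inE jG.
  exists (G `\ n), s; split=> //.
  + by apply/Hr => //; rewrite -EG.
  + move=> i j; rewrite inE => /andP[_ iG]; exact: Gs.
  + apply/fsetP => k; have /fsetP/(_ k) := E; rewrite !inE.
    have [->|] := eqVneq k n; last by [].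
    move=> _ /=; transitivity false.
      by apply/negP => /(nt n); rewrite inE eqxx ltnn => /(_ isT).
    by apply/esym/negP => /(Gs n n nG); rewrite ltnn.
- move=> [s1 [s2 [D1 D2 s12 Et]]]; subst t.
  have [n1 n2] := (fset_ltUr _ _ _).1 nt.
  exists (n |` s1), s2; split=> //; last by rewrite fsetUA.
  + exact/Hr.
  + exact/fset_ltUl.
Qed.

Context (he : fundamental_system e).

(** At a limit [c] a set with least element [n] belongs to the family of the
    [n]-th term of the sequence for [c], so this term takes over the role of [c]
    in the bounds below; it is not a limit itself. *)
Definition lead c n : W := if `[< is_limit c >] then e c n else c.

Lemma lead_limit c n : is_limit c -> lead c n = e c n.
Proof. by rewrite /lead; case: asboolP. Qed.

Lemma lead_nlimit c n : ~ is_limit c -> lead c n = c.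
Proof. by rewrite /lead; case: asboolP. Qed.

Lemma lead_le c n : (0 < n)%N -> lead c n <= c.
Proof.
move=> n0; rewrite /lead; case: asboolP => // lc.
by have [[_ lt_c _] _] := he lc; rewrite ltW // lt_c.
Qed.

(** The list [r] describes what is left of a set of B_c after removal of its
    least element [n].  The two-sided bound on its value is what makes the
    values increase with [n]. *)
Definition remainder c n r :=
  [/\ sorted <=%O r, all (fun b => b < lead c n) r, block_section n c r
    & forall b, is_succ b (lead c n) ->
        omul n.-1 (opow b) <= cnf_val r < omul n (opow b)].

Lemma remainder_ex c n : (0 < n)%N -> exists r, remainder c n r.
Proof.
move=> n0; elim/ordinal_ind: c => c IH.
have [c0|[b bc]|lc] := ordinal_cases c.
- exists [::]; split=> // [t nt|b]; last first.
    rewrite lead_nlimit; last by case.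
    by move=> bc; case: (is_succ_not_zero bc).
  split=> [/(schreierB_zeroP _ c0)[k _ /fsetP E]|->].
    apply/fsetP => j; rewrite inE; apply/negP => jt.
    have /eqP En : n == k by have := E n; rewrite !inE eqxx.
    have := E j; rewrite !inE jt orbT -En => /esym/eqP Ej.
    by have := nt n j; rewrite inE eqxx Ej ltnn -Ej => /(_ isT jt).
  by apply/(schreierB_zeroP _ c0); exists n => //; rewrite fsetU0.
- have [r [sr rb Br _]] := IH b bc.1.
  have lead_c : lead c n = c by apply: lead_nlimit; exact: is_succ_not_limit bc.
  have r_lt : all (fun a => a < b) r.
    by apply: sub_all rb => a /lt_le_trans; apply; exact: lead_le.
  exists (r ++ nseq n.-1 b); split.
  + rewrite sorted_cat_le sr /=; apply/andP; split.
      apply/allrelP => x y xr /nseqP[-> _].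
      by rewrite ltW // (allP r_lt).
    exact: sorted_nseq_le.
  + rewrite lead_c all_cat; apply/andP; split.
      by apply: sub_all r_lt => a ab; exact: lt_trans ab bc.1.
    by apply/allP => a /nseqP[-> _]; exact: bc.1.
  + move=> t nt; rewrite (schreierB_succP bc (is_min_consl nt)).
    by rewrite -{1}(prednK n0); exact: blocks_section.
  + move=> b'; rewrite lead_c => b'c; rewrite (is_succ_inj b'c bc).
    rewrite cnf_val_cat cnf_val_nseq oadd_ler /=.
    by rewrite -{2}(prednK n0) omulS oadd_ltE cnf_val_lt_opow.
- have [[_ lt_c _] nlim] := he lc.
  have [r [sr rb Br vr]] := IH _ (lt_c n n0).
  have El : lead (e c n) n = lead c n.
    by rewrite (lead_limit _ lc) lead_nlimit //; exact: nlim.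
  exists r; split=> //; rewrite -?El //.
  move=> t nt; rewrite (schreierB_limitP lc (is_min_consl nt)); exact: Br.
Qed.

(** The bounds in [remainder] separate consecutive terms.  At a limit [c], the
    value at [j] lies below [omega ^ c_j] and, for [i < j], above [omega ^ c_i]:
    as [c_j = b + 1], the ordinal [c_i] is at most [b]. *)
Lemma remainder_increasing c (r : nat -> seq W) : ~ is_zero c ->
  (forall n, (0 < n)%N -> remainder c n (r n)) ->
  increasing_to posnat (fun n => cnf_val (r n)) (opow c).
Proof.
move=> cn0 Hr.
have r_lt i : (0 < i)%N -> cnf_val (r i) < opow (lead c i).
  by move=> /Hr[_ rl _ _]; exact: cnf_val_lt_opow.
have r_lt_c i : posnat i -> cnf_val (r i) < opow c.
  by move=> i0; apply: lt_le_trans (r_lt i i0) _; rewrite opow_leE lead_le.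
have [//|[b bc]|lc] := ordinal_cases c.
- have bnd n : (0 < n)%N -> omul n.-1 (opow b) <= cnf_val (r n) < omul n (opow b).
    move=> /Hr[_ _ _]; apply; rewrite lead_nlimit //; exact: is_succ_not_limit bc.
  split=> //.
  + move=> i j i0 j0 ij; have /andP[_ ri] := bnd i i0; have /andP[rj _] := bnd j j0.
    apply: lt_le_trans ri (le_trans _ rj); apply: omul_le.
    by rewrite -ltnS (prednK j0).
  + split=> [_ [i i0 <-]|z zub]; first exact/ltW/r_lt_c.
    apply: (opow_succ bc).2 => _ [p _ <-].
    have /andP[rp _] := bnd p.+1 isT; apply: le_trans rp _.
    by apply: zub; exists p.+1.
- have [[e_lt e_c e_lub] nlim] := he lc.
  have le_r i j : (0 < i)%N -> (i < j)%N -> opow (e c i) <= cnf_val (r j).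
    move=> i0 ij; have j0 : (0 < j)%N := leq_trans i0 (ltnW ij).
    have eij := e_lt i j i0 j0 ij.
    have [ej0|[b bej]|lej] := ordinal_cases (e c j).
    - by case: (is_zero_nlt ej0 eij).
    - have [_ _ _ bnd] := Hr j j0.
      have /andP[rj _] : omul j.-1 (opow b) <= cnf_val (r j) < omul j (opow b).
        by apply: bnd; rewrite lead_limit.
      apply: le_trans rj; apply: (@le_trans _ _ (omul 1 (opow b))).
        by rewrite omul1 opow_leE -(is_succ_ltP _ bej).
      by apply: omul_le; rewrite -ltnS (prednK j0); exact: leq_ltn_trans i0 ij.
    - by case: (nlim j j0).
  split=> //.
  + move=> i j i0 j0 ij; apply: lt_le_trans (le_r i j i0 ij).
    by have := r_lt i i0; rewrite lead_limit.
  + split=> [_ [i i0 <-]|z zub]; first exact/ltW/r_lt_c.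
    apply: (opow_limit lc).2 => _ [u uc <-].
    have [_ [i i0 <-] ui] := isLub_ltP e_lub uc.
    apply: (@le_trans _ _ (opow (e c i))); first by rewrite opow_leE ltW.
    apply: le_trans (le_r i i.+1 i0 (ltnSn i)) _.
    by apply: zub; exists i.+1.
Qed.

(** * Normal forms with multiplicities *)

(** The list of exponents of the sum of the [p i] copies of [omega ^ a i] for
    [i = 0, ..., m - 1], again with the last summand first. *)
Fixpoint cnf_seq (p : nat -> nat) (a : nat -> W) (m : nat) : seq W :=
  if m is m'.+1 then nseq (p m') (a m') ++ cnf_seq p a m' else [::].

Lemma eq_cnf_seq p p' (a a' : nat -> W) m :
  (forall i, (i < m)%N -> p i = p' i /\ a i = a' i) ->
  cnf_seq p a m = cnf_seq p' a' m.
Proof.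
elim: m => //= m IH H; have [-> ->] := H m (ltnSn m).
by rewrite IH // => i im; apply: H; exact: ltnW.
Qed.

Lemma cnf_seqP c (p : nat -> nat) (a : nat -> W) m :
  c \in cnf_seq p a m -> exists2 i, (i < m)%N & c = a i.
Proof.
elim: m => //= m IH; rewrite mem_cat => /orP[/nseqP[-> _]|/IH[i im ->]].
  by exists m.
by exists i => //; exact: ltnW.
Qed.

Lemma mem_cnf_seq p (a : nat -> W) m i :
  (forall j, (j < m)%N -> (0 < p j)%N) -> (i < m)%N -> a i \in cnf_seq p a m.
Proof.
elim: m => // m IH p0; rewrite ltnS leq_eqVlt /= mem_cat => /orP[/eqP ->|im].
  by apply/orP; left; apply/nseqP; split=> //; exact: p0.
by apply/orP; right; apply: IH => // j jm; apply: p0; exact: ltnW.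
Qed.

Lemma cnf_seq_sorted p (a : nat -> W) m :
  (forall i j, (i < j)%N -> (j < m)%N -> a j < a i) -> sorted <=%O (cnf_seq p a m).
Proof.
elim: m => //= m IH a_lt; rewrite sorted_cat_le sorted_nseq_le IH ?andbT /=; last first.
  by move=> i j ij jm; apply: a_lt => //; exact: ltnW.
apply/allrelP => x y /nseqP[-> _] /cnf_seqP[i im ->].
by rewrite ltW // a_lt.
Qed.

(** Run-length encoding of a nondecreasing list. *)
Lemma cnf_seq_ex l : sorted <=%O l -> exists m p (a : nat -> W),
  [/\ forall i, (i < m)%N -> (0 < p i)%N,
      forall i j, (i < j)%N -> (j < m)%N -> a j < a i
    & l = cnf_seq p a m].
Proof.
elim: l => [_|c l IH scl].
  by exists 0%N, (fun=> 0%N), (fun=> ozero).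
have sl : sorted <=%O l := path_sorted scl.
have [m [p [a [p0 a_lt El]]]] := IH sl.
have c_le b : b \in l -> c <= b.
  by move: scl; rewrite /= le_path_sortedE => /andP[/allP H _] /H.
have [Em|[m' [Em cm]]|a_gt] : [\/ m = 0%N, exists m', m = m'.+1 /\ c = a m'
    | forall i, (i < m)%N -> c < a i].
  case: m p0 a_lt El => [|m] p0 a_lt El; first by constructor 1.
  have a_in i : (i < m.+1)%N -> a i \in l.
    by move=> im; rewrite El; exact: mem_cnf_seq.
  have := c_le _ (a_in m (ltnSn m)); rewrite le_eqVlt => /orP[/eqP E|cam].
    by constructor 2; exists m.
  constructor 3 => i; rewrite ltnS leq_eqVlt => /orP[/eqP -> //|im].
  exact: lt_trans cam (a_lt _ _ im (ltnSn m)).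
(* The list [l] is empty, [c] repeats the head of [l], or [c] is a new,
   smaller exponent. *)
- exists 1%N, (fun=> 1%N), (fun=> c); split=> //.
  + by move=> i [|j].
  + by rewrite El Em.
- exists m, (fun i => if i == m' then (p i).+1 else p i), a; split=> //.
  + by move=> i im; case: eqP => // _; exact: p0.
  + rewrite El Em /= eqxx cm; congr (_ :: _ ++ _).
    by apply: eq_cnf_seq => i im; rewrite ltn_eqF.
- exists m.+1, (fun i => if i == m then 1%N else p i).
  exists (fun i => if i == m then c else a i).
  split.
  + move=> i; rewrite ltnS leq_eqVlt; case: eqP => //= _; exact: p0.
  + move=> i j ij; rewrite ltnS leq_eqVlt => /orP[/eqP Ej|jm].
      by subst j; rewrite eqxx ltn_eqF //; exact: a_gt.
    by rewrite !ltn_eqF //; [exact: a_lt|exact: ltn_trans ij jm].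
  + rewrite /= eqxx /= El; congr (_ :: _).
    by apply: eq_cnf_seq => i im; rewrite ltn_eqF.
Qed.

Lemma cnf_val_cnf_seq p (a : nat -> W) m : cnf_val (cnf_seq p a m) =
  iteri m (fun i v => oadd v (omul (p i) (opow (a i)))) ozero.
Proof. by elim: m => //= m IH; rewrite cnf_val_cat cnf_val_nseq IH. Qed.

Lemma is_cantor_formP m p (a : nat -> W) x : is_cantor_form m p a x <->
  [/\ (0 < m)%N, forall i, (i < m)%N -> (0 < p i)%N,
      forall i, (i < m)%N -> ~ is_zero (a i),
      forall i j, (i < j)%N -> (j < m)%N -> a j < a i
    & x = cnf_val (cnf_seq p a m)].
Proof.
rewrite cnf_val_cnf_seq; split=> -[m0 p0 an0 a_lt].
- move=> [w [t [Hw Ht /is_osumE ->]]]; split=> //.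
  elim: m {m0 p0 an0 a_lt} Hw Ht => //= m IH Hw Ht.
  rewrite (IH (fun i im => Hw i (ltnW im)) (fun i im => Ht i (ltnW im))).
  congr oadd; have /is_mulP -> := Ht m (ltnSn m).
  by rewrite (is_omega_powE (Hw m (ltnSn m))).
- move=> ->; split=> //.
  exists (fun i => opow (a i)), (fun i => omul (p i) (opow (a i))).
  by split=> [i _|i _|]; [exact: opowP|exact/is_mulP|exact: is_osum_ex].
Qed.

Lemma blocks_cnf_seq p (a : nat -> W) m s : blocks (cnf_seq p a m) s <->
  exists (s_ : nat -> {fset nat}) (F : nat -> nat -> {fset nat}),
    [/\ forall i j, (i < j)%N -> (j < m)%N -> fset_lt (s_ j) (s_ i),
        forall i, (i < m)%N -> s_ i = bigfsetU (p i) (F i),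
        forall i k j, (i < m)%N -> (k < j)%N -> (j < p i)%N ->
          fset_lt (F i k) (F i j),
        forall i k, (i < m)%N -> (k < p i)%N -> schreierB e (a i) (F i k)
      & s = bigfsetU m s_].
Proof.
elim: m s => [|m IH] s.
  rewrite /= /bigfsetU; split=> [->|[s_ [F [_ _ _ _ ->]]]]; last by rewrite big_ord0.
  by exists (fun=> fset0), (fun=> fun=> fset0); split=> //; rewrite big_ord0.
rewrite /= blocks_cat; split.
- move=> [s1 [s2 [/blocks_nseq[G [G_lt BG Es1]] + s12 ->]]].
  move=> /IH[s_ [F [s_lt Es F_lt BF Es2]]].
  exists (fun i => if i == m then s1 else s_ i), (fun i => if i == m then G else F i).
  subst s2; move/fset_lt_bigr: s12 => s12; split.
  + move=> i j ij; rewrite ltnS leq_eqVlt => /orP[/eqP Ej|jm].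
      by subst j; rewrite eqxx ltn_eqF //; exact: s12.
    by rewrite !ltn_eqF //; [exact: s_lt|exact: ltn_trans ij jm].
  + by move=> i; rewrite ltnS leq_eqVlt; case: eqP => [->//|_ /= im]; exact: Es.
  + move=> i k j; rewrite ltnS leq_eqVlt; case: eqP => [-> _|_ /= im].
      exact: G_lt.
    exact: F_lt.
  + move=> i k; rewrite ltnS leq_eqVlt; case: eqP => [-> _|_ /= im]; first exact: BG.
    exact: BF.
  + rewrite bigfsetU_recr eqxx fsetUC; congr (_ `|` _).
    by apply: eq_bigfsetU => i im; rewrite ltn_eqF.
- move=> [s_ [F [s_lt Es F_lt BF ->]]].
  exists (s_ m), (bigfsetU m s_); split.
  + apply/blocks_nseq; exists (F m); split=> [i j|i|]; last exact: Es.
      exact: F_lt.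
    exact: BF.
  + apply/IH; exists s_, F; split=> //.
    * by move=> i j ij jm; apply: s_lt => //; exact: ltnW.
    * by move=> i im; apply: Es; exact: ltnW.
    * by move=> i k j im; apply: F_lt; exact: ltnW.
    * by move=> i k im; apply: BF; exact: ltnW.
  + by apply/fset_lt_bigr => i im; exact: s_lt.
  + by rewrite bigfsetU_recr fsetUC.
Qed.

(** * Sections of the families A_x, and uniformity *)

Lemma cnf_val_zero_cons c l : is_zero c -> is_succ (cnf_val l) (cnf_val (c :: l)).
Proof.
move=> c0; rewrite /= (is_zero_eq c0 ozeroP) opow0 oaddS oadd0; exact: osuccP.
Qed.

Lemma cnf_val_increasing c l (r : nat -> seq W) : ~ is_zero c ->
  (forall n, (0 < n)%N -> remainder c n (r n)) ->
  increasing_to posnat (fun n => cnf_val (r n ++ l)) (cnf_val (c :: l)).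
Proof.
move=> c0 Hr; have -> : (fun n => cnf_val (r n ++ l)) =
    (fun n => oadd (cnf_val l) (cnf_val (r n))).
  by apply/funext => n; rewrite cnf_val_cat.
exact: oadd_increasing_to (remainder_increasing c0 Hr).
Qed.

Lemma remainder_choice c :
  exists r : nat -> seq W, forall n, (0 < n)%N -> remainder c n (r n).
Proof.
suff /choice[r Hr] : forall n, exists r, (0 < n)%N -> remainder c n r by exists r.
move=> [|n]; first by exists [::].
by have [r Hr] := @remainder_ex c n.+1 isT; exists r.
Qed.

(** The remainders give an increasing sequence with this supremum. *)
Lemma cnf_val_limit c l : ~ is_zero c -> is_limit (cnf_val (c :: l)).
Proof.
move=> c0; have [r Hr] := remainder_choice c.
exact: increasing_to_limit (cnf_val_increasing l c0 Hr).
Qed.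

Lemma schreierA_blocks x s : schreierA e x s ->
  exists l, [/\ sorted <=%O l, cnf_val l = x & blocks l s].
Proof.
elim=> {x s} [a x s ax Bs|x x0|z x n s zx n0 ns _ [l [sl vl Dl]]|x m p a s_ F lx].
- exists [:: a]; split=> //; first by rewrite /= add0o -(is_omega_powE ax).
  by exists s, fset0; split=> //; rewrite fsetU0.
- by exists [::]; split=> //; exact: is_zero_eq ozeroP x0.
- exists (ozero :: l); split.
  + by rewrite /= le_path_sortedE sl andbT; apply/allP => b _; exact: ozeroP.
  + by subst z; exact: is_succ_fun (cnf_val_zero_cons l ozeroP) zx.
  + by exists [fset n], s; split=> //; apply: schreierB0 => //; exact: ozeroP.
- move=> /is_cantor_formP[m0 p0 an0 a_lt ->] s_lt Es F_lt BF.
  exists (cnf_seq p a m); split=> //; first exact: cnf_seq_sorted.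
  by apply/blocks_cnf_seq; exists s_, F.
Qed.

Lemma blocks_schreierA l s : sorted <=%O l -> blocks l s ->
  schreierA e (cnf_val l) s.
Proof.
elim: l s => [|c l IH] s scl /=.
  by move=> ->; apply: schreierA0; exact: ozeroP.
have [c0|cn0] := pselect (is_zero c).
  move=> [G [t [/(schreierB_zeroP _ c0)[n n0 ->] Dt nt ->]]].
  apply: (schreierAS (cnf_val_zero_cons l c0)) => //.
  by apply: IH => //; exact: path_sorted scl.
move=> Ds; have [m [p [a [p0 a_lt El]]]] := cnf_seq_ex scl.
have : blocks (c :: l) s by [].
rewrite El => /blocks_cnf_seq[s_ [F [s_lt Es F_lt BF ->]]].
apply: (schreierAL (p := p) (a := a)) s_lt Es F_lt BF.
  exact: cnf_val_limit.
apply/is_cantor_formP; split=> //; last by rewrite -El.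
- by case: m El {p0 a_lt}.
- move=> i im ai0; apply: cn0.
  suff : c <= a i by move=> cai y; exact: le_trans cai (ai0 y).
  have : a i \in c :: l by rewrite El; exact: mem_cnf_seq.
  rewrite inE => /orP[/eqP -> //|].
  by move: scl; rewrite /= le_path_sortedE => /andP[/allP H _] /H.
Qed.

(** A set of A_x comes from some normal form of [x]; there is only one. *)
Lemma schreierA_cnfP l s : sorted <=%O l ->
  schreierA e (cnf_val l) s <-> blocks l s.
Proof.
move=> sl; split=> [/schreierA_blocks[l' [sl' vl' Dl']]|]; last exact: blocks_schreierA.
by rewrite -(cnf_unique sl' sl vl').
Qed.

Lemma fset_lt1 n t : fset_lt [fset n] t <-> finsubsets (above n) t.
Proof.
split=> [H k kt|H i k]; first by apply: H; rewrite // inE.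
by rewrite inE => /eqP ->; exact: H.
Qed.

(** The list [r ++ l] is again nondecreasing, because the entries of [r] are
    smaller than [c]; so it is the normal form of its value. *)
Lemma section_schreierA c l n r : (0 < n)%N -> sorted <=%O (c :: l) ->
  remainder c n r ->
  section posnat (schreierA e (cnf_val (c :: l))) n =
  (schreierA e (cnf_val (r ++ l)) `&` finsubsets (above n))%classic.
Proof.
move=> n0 scl [sr r_lt Br _].
have srl : sorted <=%O (r ++ l).
  move: scl; rewrite sorted_cat_le sr /= le_path_sortedE => /andP[/allP c_le ->].
  rewrite andbT; apply/allrelP => x y /(allP r_lt) xc /c_le cy.
  exact: le_trans (ltW xc) (le_trans (lead_le c n0) cy).
apply/seteqP; split=> t.
- move=> [_ At nt]; split; last exact/fset_lt1.
  by apply/(schreierA_cnfP _ srl)/(blocks_section _ Br nt)/(schreierA_cnfP _ scl).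
- move=> [At /fset_lt1 nt]; have Dt := (schreierA_cnfP t srl).1 At.
  split=> //; first exact: blocks_pos Dt.
  by apply/(schreierA_cnfP _ scl)/(blocks_section _ Br nt).
Qed.

Lemma schreierA_succ_section z x : is_succ z x -> forall m, posnat m ->
  section posnat (schreierA e x) m =
  (schreierA e z `&` finsubsets (above m))%classic.
Proof.
move=> zx m m0; have [[|c l] sl vl] := cnf_ex x.
  by case: (is_succ_not_zero zx); rewrite -vl; exact: ozeroP.
have [c0|cn0] := pselect (is_zero c); last first.
  by case: (is_succ_not_limit zx); rewrite -vl; exact: cnf_val_limit.
have [r Hr] := remainder_ex c m0.
rewrite -vl (section_schreierA m0 sl Hr); case: Hr => _ + _ _.
case: r => [|b r] /=; last first.
  by rewrite lead_nlimit => [/andP[/(is_zero_nlt c0)]|[]].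
by rewrite (is_succ_inj zx (y := cnf_val l)) // -vl; exact: cnf_val_zero_cons.
Qed.

Lemma schreierA_limit_section x : is_limit x ->
  exists2 f : nat -> W, increasing_to posnat f x & forall m, posnat m ->
    section posnat (schreierA e x) m =
    (schreierA e (f m) `&` finsubsets (above m))%classic.
Proof.
move=> lx; have [[|c l] sl vl] := cnf_ex x.
  by case: lx => -[]; rewrite -vl; exact: ozeroP.
have [c0|cn0] := pselect (is_zero c).
  by case: (is_succ_not_limit (cnf_val_zero_cons l c0)); rewrite vl.
have [r Hr] := remainder_choice c; subst x.
exists (fun n => cnf_val (r n ++ l)); first exact: cnf_val_increasing.
by move=> m m0; exact: section_schreierA (Hr m m0).
Qed.

Lemma schreierA_sub x : (schreierA e x `<=` finsubsets posnat)%classic.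
Proof. by move=> s /schreierA_blocks[l [_ _ /blocks_pos]]. Qed.

Lemma schreierA_zero x : is_zero x -> schreierA e x = [set fset0].
Proof.
move=> x0; have -> : x = cnf_val [::] by exact: is_zero_eq x0 ozeroP.
by apply/seteqP; split=> s /(schreierA_cnfP (l := [::]) s isT).
Qed.

Lemma schreierA_fset0 x : schreierA e x fset0 -> is_zero x.
Proof.
move=> /schreierA_blocks[[|c l] [_ <- //=]]; first by move=> _; exact: ozeroP.
move=> [G [t [BG _ _ /fsetP E]]]; have [g [gG _]] := schreierB_ex_min BG.
by have := E g; rewrite !inE gG.
Qed.

Lemma increasing_to_above k (f : nat -> W) x :
  increasing_to posnat f x -> increasing_to (posnat `&` above k)%classic f x.
Proof.
move=> [f_lt fx [f_ub f_lub]]; split=> [i j [i0 _] [j0 _]|i [i0 _]|].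
- exact: f_lt.
- exact: fx.
- split=> [_ [i [i0 _] <-]|z zub]; first by apply: f_ub; exists i.
  apply: f_lub => _ [i i0 <-]; apply: (@le_trans _ _ (f (i + k.+1)%N)).
    apply/ltW/f_lt => //; last by rewrite -[X in (X < _)%N]addn0 ltn_add2l.
    by rewrite /posnat /= addnS.
  apply: zub; exists (i + k.+1)%N => //; split; first by rewrite /posnat /= addnS.
  by rewrite /above /= addnS ltnS leq_addl.
Qed.

Lemma section_above (A : set {fset nat}) k m : (k < m)%N ->
  section (posnat `&` above k)%classic (A `&` finsubsets (above k))%classic m =
  section posnat A m.
Proof.
move=> km; apply/seteqP; split=> s.
- by move=> [sM [As _] ms]; split=> // i /sM[].
- move=> [sM As ms]; have s_above : finsubsets (above k) s.
    by move=> i /((fset_lt1 m s).1 ms); rewrite /above /=; exact: ltn_trans.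
  split=> //; first by move=> i i_s; split; [exact: sM|exact: s_above].
  split=> // i; rewrite !inE => /orP[/eqP -> //|]; exact: s_above.
Qed.

Lemma above_above k m : (k < m)%N ->
  (posnat `&` above k `&` above m = posnat `&` above m)%classic.
Proof.
move=> km; apply/seteqP; split=> i [].
  by move=> [i0 _].
by move=> i0 mi; split=> //; split=> //; exact: ltn_trans km mi.
Qed.

(** Sections of A_x are taken inside sets above some [k], so the induction needs
    the statement for all restrictions of A_x at once. *)
Lemma schreierA_uniform x k : is_uniform x (posnat `&` above k)%classic
  (schreierA e x `&` finsubsets (above k))%classic.
Proof.
elim/ordinal_ind: x k => x IH k.
have n0 : ~ is_zero x ->
    ~ (schreierA e x `&` finsubsets (above k))%classic fset0.
  by move=> xn0 [/schreierA_fset0].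
have [x0|[z zx]|lx] := ordinal_cases x.
- apply: uniform0 => //; rewrite schreierA_zero //; apply/seteqP; split=> s.
    by case.
  by move=> ->; split=> // i; rewrite inE.
- apply: (uniformS zx); first exact/n0/(is_succ_not_zero zx).
  move=> m [m0 km]; rewrite section_above // above_above //.
  by rewrite (schreierA_succ_section zx) //; exact: IH zx.1 m.
- have [f f_incr Hf] := schreierA_limit_section lx.
  apply: (uniformL lx _ (increasing_to_above k f_incr)); first exact/n0/lx.1.
  move=> m [m0 km]; rewrite section_above // above_above // Hf //.
  by apply: IH; have [_ + _] := f_incr; apply.
Qed.

Lemma schreierA_uniform_system : uniform_system posnat (schreierA e).
Proof.
split=> //.
- move=> fin; apply: infinite_nat.
  apply: (@sub_finite_set _ _ (posnat `|` [set 0%N])%classic).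
    by move=> [|n] _; [right|left].
  by rewrite finite_setU; split=> //; exact: finite_set1.
- exact: schreierA_sub.
- move=> x; have := schreierA_uniform x 0.
  have E : (posnat `&` above 0 = posnat)%classic by apply/seteqP; split=> // i [].
  suff -> : (schreierA e x `&` finsubsets (above 0) = schreierA e x)%classic.
    by rewrite E.
  by apply/seteqP; split=> s => [[]//|As]; split=> //; exact: schreierA_sub As.
- exact: schreierA_succ_section.
- exact: schreierA_limit_section.
Qed.

End SchreierSystem.

Theorem theorem1p6 (d : Order.disp_t) (W : orderType d) (hW : is_omega1 W)
  (e : W -> nat -> W) (he : fundamental_system e) :
  uniform_system posnat (schreierA e).
Proof. exact: schreierA_uniform_system. Qed.
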